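(* Let $\mathcal X,\mathcal Y$ be alphabets and let $(L,R)$ be an $(\mathcal X,\mathcal Y)$-content pair. The map $\mathrm{sRSK}: w\mapsto (\mathtt T_w,\mathtt T^w)$ defines a bijection $\mathrm{RBiw}(L,R)^{\trianglelefteq}\to \mathrm{SStd}(L,R)$.
   Context: ALPHABETS. An alphabet $\mathcal X$ is a set with a parity function $\mathcal X\to\mathbb Z_2=\{\bar0,\bar1\}$, $x\mapsto\bar x$, and a total order $<$. A letter $x$ is even if $\bar x=\bar0$, odd if $\bar x=\bar1$. A second total order $\prec$ on $\mathcal X$ is defined by: $a\prec b$ iff ($\bar a=\bar1$ and $\bar b=\bar0$), or ($\bar a=\bar b=\bar0$ and $a<b$), or ($\bar a=\bar b=\bar1$ and $a>b$). TABLEAUX. Nodes are elements of $\mathsf N=\mathbb Z_{>0}\times\mathbb Z_{>0}$, partially ordered by $(r,s)\le(r',s')$ iff $r\le r'$ and $s\le s'$. For $u=(r,s)$ put $u_{\bar0}=r$ (row) and $u_{\bar1}=s$ (column). For $\varepsilon\in\mathbb Z_2$ and $i\ge1$, $\mathsf N(\varepsilon,i)=\{u\in\mathsf N: u_\varepsilon=i\}$ (the $i$th row if $\varepsilon=\bar 0$, the $i$th column if $\varepsilon=\bar 1$). The Young diagram of a partition $\lambda$ is $[\lambda]=\{(r,s)\in\mathsf N: s\le\lambda_r\}$. An $(\mathcal X,\lambda)$-tableau is a function $\mathtt T:[\lambda]\to\mathcal X$; its shape is $\mathrm{sh}(\mathtt T)=\lambda$ and its content $\mathrm{con}(\mathtt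 T)$ is the multiset $\{\mathtt T(u): u\in[\lambda]\}$. It is semistandard if: (1) $\mathtt T(u)\le\mathtt T(v)$ whenever $u\le v$; (2) if $\mathtt T(u)=\mathtt T(v)$ for distinct $u,v$ in the same row, then $\mathtt T(u)$ is even; (3) if $\mathtt T(u)=\mathtt T(v)$ for distinct $u,v$ in the same column, then $\mathtt T(u)$ is odd. $\varepsilon$-INSERTION. Extend any $(\mathcal X,\lambda)$-tableau to $\mathtt T:\mathsf N\to\mathcal X\cup\{\infty\}$ by $\mathtt T(u)=\infty$ for $u\notin[\lambda]$, with $x<\infty$ for all $x\in\mathcal X$. Let $<^{\bar0}$ denote $<$ and $<^{\bar1}$ denote $\le$. For a semistandard $(\mathcal X,\lambda)$-tableau $\mathtt T$, $\varepsilon\in\mathbb Z_2$, $x\in\mathcal X$, the tableau $(\mathtt T\xleftarrow{\varepsilon}x)$ is constructed as follows. (1) Set $i:=1$, $j:=1$, $x_1:=x$. (2) Let $b_j$ be the smallest node in $\mathsf N(\varepsilon+\bar x_j,i)$ such that $x_j<^{\varepsilon}\mathtt T(b_j)$. (3) If $\mathtt T(b_j)=\infty$ go to (5); otherwise set $j:=j+1$. (4) Set $x_j:=\mathtt T(b_{j-1})$ and $i:=(b_{j-1})_{\varepsilon+\bar x_j}+1$, and go to (2). (5) Define $\mu$ by $[\mu]=[\lambda]\cup\{b_j\}$, and let $(\mathtt T\xleftarrow{\varepsilon}x)$ be the $(\mathcal X,\mu)$-tableau with value $x_k$ at $b_k$ for $1\le k\le j$ and value $\mathtt T(u)$ at all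 other nodes $u$ of $[\mu]$. If the process terminates at $j=m$, $b_m$ is called the added node of the insertion. The result is again semistandard. BIWORDS. An $(\mathcal X,\mathcal Y)$-biletter is an element of $\mathcal X\times\mathcal Y$; $(x,y)$ is mixed if $\bar x+\bar y=\bar1$. Biletters are totally ordered by $(x_1,y_1)\triangleleft(x_2,y_2)$ iff $y_1<y_2$, or $y_1=y_2$ and $x_1\prec x_2$. A biword of length $k\in\mathbb Z_{>0}$ is $w=((x_1,y_1),\dots,(x_k,y_k))\in(\mathcal X\times\mathcal Y)^k$. It is restricted if $(x_i,y_i)=(x_j,y_j)$ for $i\ne j$ only if $\bar x_i+\bar y_i=\bar0$. It is ordered if $(x_i,y_i)\trianglelefteq(x_j,y_j)$ for all $i\le j$. Its left content is the multiset $\{x_1,\dots,x_k\}$ and its right content is the multiset $\{y_1,\dots,y_k\}$. An $(\mathcal X,\mathcal Y)$-content pair of length $k$ is a pair $(L,R)$ with $L$ a multiset of elements of $\mathcal X$, $R$ a multiset of elements of $\mathcal Y$, $|L|=|R|=k$. $\mathrm{RBiw}(L,R)^{\trianglelefteq}$ is the set of ordered restricted biwords with left content $L$ and right content $R$. $\mathrm{SStd}(L,R)$ is the set of pairs $(\mathtt L,\mathtt R)$ of semistandard tableaux ($\mathtt L$ with entries in $\mathcal X$, $\mathtt R$ with entries in $\mathcal Y$) with $\mathrm{sh}(\mathtt L)=\mathrm{sh}(\mathtt R)$, $\mathrm{con}(\mathtt L)=L$, $\mathrm{con}(\mathtt R)=R$. THE MAP sRSK. For $w=((x_1,y_1),\dots,(x_k,y_k))\in\mathrm{RBiw}(L,R)^{\trianglelefteq}$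 put $\mathtt T_w^0=\varnothing$ and $\mathtt T_w^i=(\mathtt T_w^{i-1}\xleftarrow{\bar y_i}x_i)$ for $1\le i\le k$, and let $a_w^i$ be the added node of this $i$th insertion. The insertion tableau is $\mathtt T_w:=\mathtt T_w^k$; the recording tableau $\mathtt T^w$ is the $(\mathcal Y,\mathrm{sh}(\mathtt T_w))$-tableau with $\mathtt T^w(a_w^i)=y_i$. Set $\mathrm{sRSK}(w)=(\mathtt T_w,\mathtt T^w)$. *)

(* Defs.v *)
From mathcomp Require Import all_boot all_order.
From mathcomp Require Import finmap multiset.
From mathcomp Require Import boolp classical_sets functions.

Set Implicit Arguments.
Unset Strict Implicit.
Unset Printing Implicit Defensive.

Import Order.TTheory.

Local Open Scope order_scope.
Local Open Scope fset_scope.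
Local Open Scope fmap_scope.

(* Z_2 is bool: false is even, true is odd, and addb (+) is its addition. An
   alphabet is a totally ordered type X with a parity function par : X -> bool. *)

(* Nodes are (row, column), counted from 0 instead of 1. *)
Definition node : Type := nat * nat.

Definition node_le (u v : node) : bool := (u.1 <= v.1)%N && (u.2 <= v.2)%N.

(* u_e: the row of u if e is even, its column if e is odd. *)
Definition coord (e : bool) (u : node) : nat := if e then u.2 else u.1.

(* The k-th smallest element of N(e, i) = {u | coord e u = i}. *)
Definition line_node (e : bool) (i k : nat) : node := if e then (k, i) else (i, k).

Definition is_part (lam : seq nat) : bool := sorted geq lam && (0%N \notin lam).

Definition diagram (lam : seq nat) : pred node := [pred u | (u.2 < nth 0 lam u.1)%N].

(* Shapes are not stored: a tableau is a finite map, and T is an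
   (X, lam)-tableau when its domain is the Young diagram of lam. The extension
   of T by oo outside its domain is T.[? u], with None playing the role of oo. *)
Notation tableau X := {fmap nat * nat -> X}.

Section Alphabet.

Context {disp : Order.disp_t} {X : orderType disp} (par : X -> bool).
Implicit Types (T : tableau X) (x y : X) (e : bool).

Definition prec x y : bool :=
  [|| par x && ~~ par y,
      [&& ~~ par x, ~~ par y & x < y]
    | [&& par x, par y & y < x]].

Definition is_tableau (lam : seq nat) T : Prop := domf T =i diagram lam.

Definition content T : {mset X}%mset := seq_mset (codom T).

Definition semistandard T : Prop :=
  [/\ forall u v : domf T, node_le (val u) (val v) -> T u <= T v,
      forall u v : domf T,
        u != v -> (val u).1 = (val v).1 -> T u = T v -> ~~ par (T u)
    & forall u v : domf T,
        u != v -> (val u).2 = (val v).2 -> T u = T v -> par (T u)].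

(* x <^e o, where <^0 is < and <^1 is <=, and None is oo. *)
Definition lt_eps e x (o : option X) : bool :=
  if o is Some y then (if e then x <= y else x < y) else true.

Lemma ex_landing T e x i :
  exists k, lt_eps e x T.[? line_node (e (+) par x) i k].
Proof.
set f := line_node _ i.
have f_inj : injective f by rewrite /f /line_node => k l; case: ifP => _ [].
have [k] : exists k, f k \notin domf T; last first.
  by move=> kT; exists k; rewrite not_fnd.
have /allPn[u /mapP[k _ ->] kT] :
    ~~ all (mem (domf T)) [seq f k | k <- iota 0 #|` domf T|.+1].
  apply/negP => /allP sub; suff : (#|` domf T|.+1 <= #|` domf T|)%N by rewrite ltnn.
  rewrite -{1}(size_iota 0 #|` domf T|.+1) -(size_map f).
  by apply: uniq_leq_size => //; rewrite map_inj_uniq ?iota_uniq.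
by exists k.
Qed.

(* The smallest node b of N(e + par x, i) such that x <^e T(b). *)
Definition landing T e x (i : nat) : node :=
  line_node (e (+) par x) i (ex_minn (ex_landing T e x i)).

(* The pairs (b_j, x_j), (b_(j+1), x_(j+1)), ..., from the current letter
   x = x_j and line i, stopping at the first b outside the domain of T.
   By bump_path_stops below, the fuel n = #|` domf T| is always enough. *)
Fixpoint bump_path T e (n : nat) x (i : nat) : seq (node * X) :=
  let b := landing T e x i in
  (b, x) :: match n, T.[? b] with
            | n'.+1, Some y => bump_path T e n' y (coord (e (+) par y) b).+1
            | _, _ => [::]
            end.

Definition insertion_path T e x : seq (node * X) :=
  bump_path T e #|` domf T| x 0.

Definition insertion T e x : tableau X :=
  foldl (fun S p => S.[p.1 <- p.2]) T (insertion_path T e x).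

Definition added_node T e x : node :=
  last (0, 0)%N [seq p.1 | p <- insertion_path T e x].

(* The nodes that can still be visited from the current letter x and line i. *)
Definition reachable T e x i : {fset nat * nat} :=
  [fset u in domf T | if T.[? u] is Some y then
     (x < y) || [&& e, y == x & (i <= coord (e (+) par x) u)%N] else false].

Lemma bump_path_stops T e n x i : (#|` reachable T e x i| <= n)%N ->
  last (0, 0)%N [seq p.1 | p <- bump_path T e n x i] \notin domf T.
Proof.
have coordK f j k : coord f (line_node f j k) = j by case: f.
have step z j y : T.[? landing T e z j] = Some y ->
    landing T e z j \in reachable T e z j /\
    reachable T e y (coord (e (+) par y) (landing T e z j)).+1
      `<=` reachable T e z j `\ landing T e z j.
  move=> Ty; set b := landing T e z j in Ty *.
  have bT : b \in domf T by rewrite -fndSome Ty.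
  have bc : coord (e (+) par z) b = j by exact: coordK.
  have : lt_eps e z T.[? b] by rewrite /b /landing; case: ex_minnP.
  rewrite Ty /= => zy; split.
    rewrite !inE /= bT Ty bc leqnn andbT /=.
    by move: zy; case: (e); rewrite /= ?orbF // le_eqVlt eq_sym orbC.
  apply/fsubsetP => u; rewrite !inE /= => /andP[-> /=].
  case Tu: (T.[? u]) => [y'|//] /orP[yy'|/and3P[e1 /eqP yy' iu]].
    apply/andP; split.
      by apply: contraTneq yy' => ub; move: Tu; rewrite ub Ty => -[->]; rewrite ltxx.
    suff -> : z < y' by [].
    by move: zy yy'; case: (e); [exact: le_lt_trans | exact: lt_trans].
  rewrite {}yy' in Tu *; apply/andP; split.
    by apply: contraTneq iu => ->; rewrite ltnn.
  have : z <= y by move: zy; rewrite e1.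
  rewrite le_eqVlt => /orP[/eqP zy'|-> //].
  by move: iu; rewrite -zy' bc e1 eqxx => /ltnW ->; rewrite orbT.
elim: n x i => [|n IHn] x i /=.
  case Ty: (T.[? landing T e x i]) => [y|]; last by rewrite -fndSome Ty.
  have [bR _] := step _ _ _ Ty.
  by rewrite leqn0 cardfs_eq0 => /eqP R0; rewrite R0 inE in bR.
case Ty: (T.[? landing T e x i]) => [y|] le_n; last by rewrite /= -fndSome Ty.
have [bR sub] := step _ _ _ Ty.
have : (#|` reachable T e y (coord (e (+) par y) (landing T e x i)).+1| <= n)%N.
  rewrite (leq_trans (fsubset_leq_card sub)) // -ltnS (leq_trans _ le_n) //.
  by rewrite [leqRHS](cardfsD1 (landing T e x i)) bR.
by move=> /IHn; case: (n) => [|n'] /=.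
Qed.

Lemma added_nodeP T e x : added_node T e x \notin domf T.
Proof.
apply: bump_path_stops; apply: fsubset_leq_card.
by apply/fsubsetP => u; rewrite !inE => /andP[].
Qed.

End Alphabet.

Section Biwords.

Context {dX dY : Order.disp_t} {X : orderType dX} {Y : orderType dY}.
Context (parX : X -> bool) (parY : Y -> bool).
Implicit Types (b c : X * Y).

Definition mixed b : bool := parX b.1 (+) parY b.2.

Definition biletter_lt b c : bool :=
  (b.2 < c.2) || (b.2 == c.2) && prec parX b.1 c.1.

Definition biletter_le b c : bool := (b == c) || biletter_lt b c.

Definition restricted k (w : k.-tuple (X * Y)) : Prop :=
  forall i j : 'I_k, i != j -> tnth w i = tnth w j -> ~~ mixed (tnth w i).

Definition ordered k (w : k.-tuple (X * Y)) : Prop :=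
  forall i j : 'I_k, (i <= j)%N -> biletter_le (tnth w i) (tnth w j).

Definition RBiw k (L : {mset X}%mset) (R : {mset Y}%mset) : set (k.-tuple (X * Y)) :=
  [set w | [/\ restricted w, ordered w,
               seq_mset [seq b.1 | b <- w] = L
             & seq_mset [seq b.2 | b <- w] = R]]%classic.

Definition SStd (L : {mset X}%mset) (R : {mset Y}%mset) : set (tableau X * tableau Y) :=
  [set PQ | [/\ exists2 lam, is_part lam &
                  is_tableau lam PQ.1 /\ is_tableau lam PQ.2,
                semistandard parX PQ.1, semistandard parY PQ.2,
                content PQ.1 = L & content PQ.2 = R]]%classic.

Definition sRSK_step (PQ : tableau X * tableau Y) b : tableau X * tableau Y :=
  (insertion parX PQ.1 (parY b.2) b.1,
   PQ.2.[added_node parX PQ.1 (parY b.2) b.1 <- b.2]).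

Definition sRSK k (w : k.-tuple (X * Y)) : tableau X * tableau Y :=
  foldl sRSK_step ([fmap], [fmap]) w.

End Biwords.

(* Main.v *)
Require Import Defs.
From mathcomp Require Import all_boot all_order.
From mathcomp Require Import finmap multiset.
From mathcomp Require Import boolp classical_sets functions.
From mathcomp Require Import zify.

(* The proof replaces insertion by Fomin-style local rules. Listing the entries
   of a semistandard tableau in increasing order (equal even letters from left
   to right, equal odd letters from top to bottom) turns it into a growth of
   Young diagrams, one box at a time. Inserting x adds a box a to each diagram
   of the growth from the place of x on; when the next box c of the growth, with
   letter z, differs from a, both are kept, and when a = c, both become the end
   of the line of N(e + par z, _) that follows the one of c. This rule is
   invertible and symmetric in a and c. It also preserves, for two successive
   steps of the same direction, which of the two boxes is further right; in one
   direction this says that insertion preserves semistandardness, and in the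
   other that successive insertions with the same e add boxes whose relative
   position tells whether the inserted letters form an ordered restricted
   biword. *)

Set Implicit Arguments.
Unset Strict Implicit.
Unset Printing Implicit Defensive.

Import Order.TTheory.

Local Open Scope order_scope.
Local Open Scope fset_scope.
Local Open Scope fmap_scope.

(** * Young diagrams and the local rule *)

Section Shapes.

Implicit Types (D : {fset nat * nat}) (a b c d u v : nat * nat) (k q : bool).

Lemma coord_eq k u v :
  coord k u = coord k v -> coord (~~ k) u = coord (~~ k) v -> u = v.
Proof. by case: u v k => [u1 u2] [v1 v2] [] /= -> ->. Qed.

Lemma node_leE k u v :
  node_le u v = (coord k u <= coord k v)%N && (coord (~~ k) u <= coord (~~ k) v)%N.
Proof. by rewrite /node_le; case: k => //=; rewrite andbC. Qed.

Lemma coord_line q i j : coord q (line_node q i j) = i.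
Proof. by case: q. Qed.

Lemma coord_lineN q i j : coord (~~ q) (line_node q i j) = j.
Proof. by case: q. Qed.

Lemma line_nodeK q u : line_node q (coord q u) (coord (~~ q) u) = u.
Proof. by case: q u => [] []. Qed.

Definition young D := forall u v, v \in D -> node_le u v -> u \in D.

Definition addable D c := [/\ young D, c \notin D & young (c |` D)].

Lemma young0 : young fset0.
Proof. by move=> u v; rewrite inE. Qed.

Lemma youngI D D' : young D -> young D' -> young (D `&` D').
Proof.
move=> yD yD' u v; rewrite !inE => /andP[vD vD'] uv.
by rewrite (yD _ _ vD uv) (yD' _ _ vD' uv).
Qed.

Lemma addable_le k D c u : addable D c -> u \notin D ->
  (coord k u <= coord k c)%N -> (coord (~~ k) u <= coord (~~ k) c)%N -> u = c.
Proof.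
move=> [_ _ yc] uD h1 h2; have := yc u c; rewrite !inE eqxx (node_leE k) h1 h2.
by rewrite (negPf uD) orbF => /(_ isT isT)/eqP.
Qed.

Lemma young_notin k D u v : young D -> v \in D -> u \notin D ->
  (coord k u <= coord k v)%N -> (coord (~~ k) v < coord (~~ k) u)%N.
Proof.
move=> yD vD uD h; rewrite ltnNge; apply: contra uD => h'.
by apply: (yD _ _ vD); rewrite (node_leE k) h h'.
Qed.

Lemma addable_incomp k D a c : addable D a -> addable D c -> a <> c ->
  (coord k a <= coord k c)%N ->
  (coord k a < coord k c)%N /\ (coord (~~ k) c < coord (~~ k) a)%N.
Proof.
move=> aD cD ac h; split; last first.
  rewrite ltnNge; apply/negP => h'; apply: ac; apply: (addable_le cD _ h h').
  by case: aD.
rewrite ltn_neqAle h andbT; apply/negP => /eqP h1.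
case: (leqP (coord (~~ k) a) (coord (~~ k) c)) => h2; apply: ac.
  by apply: (addable_le cD _ h h2); case: aD.
apply/esym; apply: (@addable_le k _ _ _ aD); last exact: ltnW.
  by case: cD.
by rewrite h1.
Qed.

(** If [v] were strictly beyond [u] in both coordinates, the corner [w] would have to be present
    before [v]; being different from [u], it would lie in [D], and then so would [u]. So two
    successive boxes go strictly right and weakly up, or strictly down and weakly left. *)
Lemma addable_dichotomy k D u v : addable D u -> addable (u |` D) v ->
  (coord k u < coord k v)%N = (coord (~~ k) v <= coord (~~ k) u)%N.
Proof.
move=> [yD uD yu] vD; have uuD : u \in u |` D by rewrite !inE eqxx.
have [_ vuD _] := vD.
case: (ltnP (coord k u)) => h; last first.
  by have := young_notin yu uuD vuD h; case: leqP => //; lia.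
apply/esym; rewrite leqNgt; apply/negP => h'.
pose w := line_node (~~ k) (coord (~~ k) u) (coord k v).
have wk : coord k w = coord k v by rewrite /w; case: (k).
have wk' : coord (~~ k) w = coord (~~ k) u by rewrite /w; case: (k).
case: (boolP (w \in u |` D)) => wD.
  move: wD; rewrite !inE => /orP[/eqP wu|wD]; first by rewrite -wk wu ltnn in h.
  by move/negP: uD; apply; apply: (yD _ _ wD); rewrite (node_leE k) wk wk' ltnW /=.
have wv := @addable_le k _ _ _ vD wD.
by move: (h'); rewrite -wk' wv ?ltnn ?wk ?wk' // ltnW.
Qed.

Lemma addableU D a c : addable D a -> addable D c -> a <> c -> addable (a |` D) c.
Proof.
move=> [yD aD ya] [_ cD yc] ac; split=> //.
  by rewrite !inE (negPf cD) orbF; apply/eqP => ca; case: ac.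
move=> u v; rewrite !inE => /or3P[/eqP->|/eqP->|vD] uv.
- by have := yc u c; rewrite !inE eqxx => /(_ isT uv)/orP[]->; rewrite ?orbT.
- by have := ya u a; rewrite !inE eqxx => /(_ isT uv)/orP[]->; rewrite ?orbT.
- by rewrite (yD _ _ vD uv) !orbT.
Qed.

(** * Ends of lines and bumped boxes *)

Lemma ex_endline D q i : exists j, line_node q i j \notin D.
Proof.
exists (\max_(u <- D) coord (~~ q) u).+1; apply/negP => uD.
have := leq_bigmax_seq (P := xpredT) (F := coord (~~ q)) _ uD isT.
by rewrite coord_lineN ltnn.
Qed.

Definition endline D q i : nat * nat := line_node q i (ex_minn (ex_endline D q i)).

Lemma coord_endline D q i : coord q (endline D q i) = i.
Proof. exact: coord_line. Qed.

Lemma endline_notin D q i : endline D q i \notin D.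
Proof. by rewrite /endline; case: ex_minnP. Qed.

Lemma endline_min D q u : u \notin D ->
  (coord (~~ q) (endline D q (coord q u)) <= coord (~~ q) u)%N.
Proof.
move=> uD; rewrite /endline; case: ex_minnP => j _ jmin; rewrite coord_lineN.
by apply: jmin; rewrite line_nodeK.
Qed.

Lemma addable_endline D q c : addable D c -> endline D q (coord q c) = c.
Proof.
move=> cD; apply: (@addable_le q _ _ _ cD); rewrite ?endline_notin ?coord_endline//.
by apply: endline_min; case: cD.
Qed.

Lemma endline_addable D q i : young D ->
  (forall u, coord q u < i -> coord (~~ q) u <= coord (~~ q) (endline D q i) ->
     u \in D)%N ->
  addable D (endline D q i).
Proof.
move=> yD h; split; rewrite ?endline_notin// => u v.
rewrite !inE => /orP[/eqP->|vD uv]; last by rewrite (yD _ _ vD uv) orbT.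
rewrite (node_leE q) coord_endline => /andP[ui uj].
apply/orP; case: (boolP (u \in D)) => [uD|uD]; [by right|left].
move: ui; rewrite leq_eqVlt => /orP[/eqP ui|ui]; last by rewrite h in uD.
have := endline_min q uD; rewrite ui => uj'; apply/eqP/(@coord_eq q).
  by rewrite coord_endline.
by apply/eqP; rewrite eqn_leq uj.
Qed.

Lemma endline0_addable D q : young D -> addable D (endline D q 0).
Proof. by move=> yD; apply: endline_addable. Qed.

Definition bump_node D q c := endline (c |` D) q (coord q c).+1.

(** The node [v] beside [c] in the next line is still free, since [c] was not in [D]. So that line
    ends no further than [c], and the earlier lines already reach that far. *)
Lemma bump_node_addable D q c : addable D c -> addable (c |` D) (bump_node D q c).
Proof.
move=> cD; have [_ _ yc] := cD; apply: endline_addable => // u uc.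
have ccD : c \in c |` D by rewrite !inE eqxx.
suff le_c : (coord (~~ q) (bump_node D q c) <= coord (~~ q) c)%N.
  move=> /leq_trans /(_ le_c) ujc.
  by apply: (yc _ _ ccD); rewrite (node_leE q) ujc andbT.
pose v := line_node q (coord q c).+1 (coord (~~ q) c).
have vD : v \notin c |` D.
  apply/negP; rewrite !inE => /orP[/eqP vc|vD].
    by have := coord_line q (coord q c).+1 (coord (~~ q) c); rewrite -/v vc; lia.
  case: cD => yD /negP + _; apply; apply: (yD _ _ vD).
  by rewrite (node_leE q) coord_line coord_lineN leqnSn leqnn.
by move: (endline_min q vD); rewrite /v coord_line coord_lineN.
Qed.

Lemma coord_bump_node D q c : coord q (bump_node D q c) = (coord q c).+1.
Proof. exact: coord_endline. Qed.

(* [a] and [c] are boxes that can be added to [D], where [c] is the next box of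
   a growth; the result is the box that replaces [c] over [a |` D] and the box
   inserted over [c |` D]. *)
Definition local_rule q D a c : (nat * nat) * (nat * nat) :=
  if a == c then (bump_node D q c, bump_node D q c) else (c, a).

Lemma local_ruleC q D a c :
  local_rule q D c a = ((local_rule q D a c).2, (local_rule q D a c).1).
Proof. by rewrite /local_rule eq_sym; case: eqP => [->|]. Qed.

Lemma local_rule_addable q D a c : addable D a -> addable D c ->
  addable (a |` D) (local_rule q D a c).1 /\ addable (c |` D) (local_rule q D a c).2.
Proof.
move=> aD cD; rewrite /local_rule; case: eqP => [->|ac] /=.
  by split; apply: bump_node_addable.
by split; apply: addableU => // ca; apply: ac.
Qed.

Lemma local_rule_shape q D a c :
  (local_rule q D a c).1 |` (a |` D) = (local_rule q D a c).2 |` (c |` D).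
Proof. by rewrite /local_rule; case: eqP => [->|ac] //=; rewrite fsetUCA. Qed.

(** A bump moves a box exactly one line further in direction [q]. For [k = q] this is compared
    directly with the old coordinates; otherwise the dichotomy or the incomparability of addable
    boxes first turns the claim into one about [q]-coordinates. *)
Lemma local_rule_mono k q D a c1 c2 :
  addable D a -> addable D c1 -> addable (c1 |` D) c2 ->
  let: (d1, b1) := local_rule q D a c1 in
  (coord k c1 < coord k c2)%N ->
  (coord k d1 < coord k (local_rule q (c1 |` D) b1 c2).1)%N.
Proof.
move=> aD c1D c2D; rewrite /local_rule.
have [_ _ yc1] := c1D; have [_ c2n yc2] := c2D.
case: eqP => [ac1|ac1]; case: eqP => [bc2|bc2] //=.
- rewrite -bc2 => h; have := h; rewrite (addable_dichotomy _ c1D).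
    case: (eqVneq k q) => [->|/eqP kq]; first by rewrite !coord_bump_node.
    have -> : ~~ k = q by move: kq; case: (k); case: (q).
    by rewrite coord_bump_node ltnn.
  exact: bump_node_addable.
- have bD : addable (c1 |` D) (bump_node D q c1) by apply: bump_node_addable.
  move=> h; case: (eqVneq k q) => [kq|/eqP kq].
    by apply: (proj1 (addable_incomp bD c2D bc2 _)); rewrite kq coord_bump_node -kq.
  have kq' : ~~ k = q by move: kq; case: (k); case: (q).
  have h' := h; rewrite (addable_dichotomy _ c1D c2D) in h'.
  have := addable_incomp (k := q) c2D bD (fun e => bc2 (esym e)).
  rewrite coord_bump_node -kq' negbK => -[]; [exact: leqW | by []].
- rewrite -bc2 in c2D c2n yc2 * => h.
  case: (eqVneq k q) => [kq|/eqP kq].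
    by rewrite kq coord_bump_node ltnS ltnW -?kq.
  have kq' : ~~ k = q by move: kq; case: (k); case: (q).
  have [_] := addable_incomp c1D aD (fun e => ac1 (esym e)) (ltnW h).
  have bD := bump_node_addable q c2D.
  move=> h'; have := @young_notin q _ (bump_node (c1 |` D) q a) c1 yc2.
  rewrite !inE eqxx orbT => /(_ isT); rewrite coord_bump_node -kq' negbK; apply=> //.
  by case: bD => _; rewrite kq' !inE.
Qed.

(** By [addable_dichotomy], not advancing in direction [k] is advancing in direction [~~ k], so the
    converse is [local_rule_mono] for [~~ k]. *)
Lemma local_rule_mono_iff k q D a c1 c2 :
  addable D a -> addable D c1 -> addable (c1 |` D) c2 ->
  let: (d1, b1) := local_rule q D a c1 in
  (coord k d1 < coord k (local_rule q (c1 |` D) b1 c2).1)%N =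
  (coord k c1 < coord k c2)%N.
Proof.
move=> aD c1D c2D.
have mono k' := @local_rule_mono k' q _ _ _ _ aD c1D c2D.
have [] := local_rule_addable q aD c1D; have := local_rule_shape q D a c1.
case: (local_rule q D a c1) mono => d1 b1 mono /= shE d1D b1D.
apply/idP/idP; last exact: mono.
have [d2D _] := local_rule_addable q b1D c2D; rewrite -shE in d2D.
rewrite (addable_dichotomy _ d1D d2D) (addable_dichotomy _ c1D c2D) => h.
by rewrite leqNgt; apply/negP => /mono; rewrite ltnNge h.
Qed.

(** The transposed form, through the symmetry [local_ruleC]: [a1] and [a2] are now two boxes
    inserted one after the other at a stage whose next box is [c]. *)
Lemma local_rule_mono_iffV k q D c a1 a2 :
  addable D c -> addable D a1 -> addable (a1 |` D) a2 ->
  let: (d1, b1) := local_rule q D a1 c in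
  (coord k b1 < coord k (local_rule q (a1 |` D) a2 d1).2)%N =
  (coord k a1 < coord k a2)%N.
Proof.
move=> cD a1D a2D; have := local_rule_mono_iff k q cD a1D a2D.
rewrite (local_ruleC _ _ a1); case: (local_rule q D a1 c) => d1 b1 /=.
by rewrite (local_ruleC _ _ a2).
Qed.

Lemma coord_local_rule0 q D a c : addable D a -> addable D c -> coord q c = 0 ->
  (0 < coord q (local_rule q D a c).2)%N.
Proof.
move=> aD cD c0; rewrite /local_rule; case: eqP => [_|ac] /=.
  by rewrite coord_bump_node.
have [|] := @addable_incomp q _ c a cD aD (fun e => ac (esym e)); rewrite c0//.
Qed.

(** The bumped box determines the line of [c], and [c] is the last node of the enlarged diagram in
    that line. *)
Lemma bump_node_inj q D D' c c' : addable D c -> addable D' c' ->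
  c |` D = c' |` D' -> bump_node D q c = bump_node D' q c' -> c = c'.
Proof.
move=> cD cD' DD' /(congr1 (coord q)); rewrite !coord_bump_node => -[cc].
have cc' : c \notin D' \/ c' \notin D.
  case: (boolP (c \in D')) => [h|]; [right|by left].
  case: (eqVneq c c') => [<-|ne]; first by case: cD.
  case: (leqP (coord (~~ q) c') (coord (~~ q) c)) => h'.
    case: cD' => yD' /negP c'D' _; case: c'D'; apply: (yD' _ _ h).
    by rewrite (node_leE q) cc leqnn.
  apply/negP => c'D; case: cD => yD /negP + _; apply; apply: (yD _ _ c'D).
  by rewrite (node_leE q) cc leqnn ltnW.
case: cc' => h.
  have : c \in c' |` D' by rewrite -DD' !inE eqxx.
  by rewrite !inE (negPf h) orbF => /eqP.
have : c' \in c |` D by rewrite DD' !inE eqxx.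
by rewrite !inE (negPf h) orbF => /eqP.
Qed.

Lemma addable_rem D b : b \in D -> young D -> young (D `\ b) -> addable (D `\ b) b.
Proof. by move=> bD yD yb; split; rewrite ?fsetD1K // !inE eqxx. Qed.

(** The box to recover is the last node of the line before that of [d]. It is a corner because the
    lines from that of [d] on stop short of it. *)
Lemma bump_node_surj D q d : addable D d -> (0 < coord q d)%N ->
  exists2 c, c \in D & addable (D `\ c) c /\ bump_node (D `\ c) q c = d.
Proof.
move=> dD d0; have [yD dn _] := dD; case dq: (coord q d) d0 => [//|i] _.
pose w := endline D q i.
have wc : coord q w = i := coord_endline _ _ _.
have wn : w \notin D := endline_notin _ _ _.
have dw : (coord (~~ q) d < coord (~~ q) w)%N.
  rewrite ltnNge; apply/negP => h; have := @addable_le q _ _ _ dD wn.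
  by rewrite wc dq leqnSn => /(_ isT h) wd; rewrite -wd wc in dq; lia.
(* By [dw] the coordinate of [w] is positive, so the predecessor is not truncated. *)
pose c := line_node q i (coord (~~ q) w).-1.
have cq : coord q c = i by rewrite coord_line.
have cq' : coord (~~ q) c = (coord (~~ q) w).-1 by rewrite coord_lineN.
have cD : c \in D.
  apply/negPn/negP => /(endline_min q).
  by rewrite cq cq' -/w; lia.
have cad : addable (D `\ c) c.
  apply: addable_rem => // u v; rewrite !inE => /andP[vc vD] uv.
  rewrite (yD _ _ vD uv) andbT; apply/eqP => uc; subst u; case/negP: vc.
  move: uv; rewrite (node_leE q) cq cq' => /andP[iv jv].
  case: (ltngtP i (coord q v)) iv => // iv _.
    have := young_notin yD vD dn; move/(_ q); rewrite dq => /(_ iv); lia.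
  have := @young_notin q _ w v yD vD wn; rewrite wc iv => /(_ (leqnn _)) h.
  by apply/eqP/(@coord_eq q); rewrite ?cq ?cq' //; lia.
exists c => //; split=> //.
by rewrite /bump_node fsetD1K // cq -dq addable_endline.
Qed.

(** * Young diagrams and partitions *)

Lemma is_part_young lam (D : {fset nat * nat}) :
  is_part lam -> D =i diagram lam -> young D.
Proof.
move=> /andP[slam _] DE u v; rewrite !DE !inE /node_le => vlam /andP[u1 u2].
apply: leq_ltn_trans u2 (leq_trans vlam _).
case: (ltnP v.1 (size lam)) => h; last by rewrite (nth_default _ h).
have geq_trans : transitive geq by move=> x y z /= xy yz; exact: leq_trans yz xy.
have := sorted_leq_nth geq_trans (fun x => leqnn x) 0%N slam.
move/(_ u.1 v.1); rewrite !inE; apply=> //; exact: leq_ltn_trans h.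
Qed.

Lemma young_is_part D : young D -> exists2 lam, is_part lam & D =i diagram lam.
Proof.
(* Nodes being counted from 0, the first missing node of a row gives its length, and that of column
   0 the number of nonempty rows. *)
move=> yD; pose len r := (endline D false r).2.
pose n := (endline D true 0).1.
have lenP u : (u \in D) = (u.2 < len u.1)%N.
  apply/idP/idP => [uD|].
    exact: (young_notin (k := false) yD uD (endline_notin D false u.1)).
  by apply: contraTT => /(endline_min false) /=; rewrite -leqNgt.
have nP r : (r < n)%N = (0 < len r)%N.
  rewrite -[RHS](lenP (r, 0)%N); apply/idP/idP => [|uD].
    by apply: contraTT => /(endline_min true) /=; rewrite -leqNgt.
  exact: (young_notin (k := true) yD uD (endline_notin D true 0)).
have nthE r : nth 0%N (mkseq len n) r = len r.
  case: (ltnP r n) => h; first by rewrite nth_mkseq.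
  rewrite nth_default ?size_mkseq//; apply/esym/eqP; rewrite -leqn0 leqNgt -nP; lia.
exists (mkseq len n); last by move=> u; rewrite lenP inE nthE.
apply/andP; split.
  apply/(sortedP 0%N) => i; rewrite !nthE /= => _.
  rewrite leqNgt; apply/negP => h; have := lenP (i.+1, len i); rewrite h.
  by move/yD => /(_ (i, len i)); rewrite lenP /node_le /= leqnSn leqnn ltnn => /(_ isT).
apply/negP => /mapP[r]; rewrite mem_iota add0n /= => rn; move: rn; rewrite nP; lia.
Qed.

End Shapes.

(** * Insertion into a growth *)

Section Growth.

Context {disp : Order.disp_t} {X : orderType disp} (par : X -> bool).
Implicit Types (s t : seq (X * node)) (p q : X * node) (x z h : X) (e : bool).
Implicit Types (D : {fset nat * nat}) (a b c d : nat * nat).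

(** The standardization order; [~~ par] selects the column for an even letter and the row for an odd
    one. *)
Definition std_lt p q : bool :=
  (p.1 < q.1) ||
  (p.1 == q.1) && (coord (~~ par p.1) p.2 < coord (~~ par p.1) q.2)%N.

Definition std_lt_head p s : bool := if s is q :: _ then std_lt q p else true.

Fixpoint boxes s : {fset nat * nat} :=
  if s is p :: s' then p.2 |` boxes s' else fset0.

(* Growths are listed from the last box to the first. *)
Fixpoint growth s : Prop :=
  if s is p :: s' then
    [/\ growth s', addable (boxes s') p.2 & std_lt_head p s']
  else True.

Definition before e x s : bool :=
  if s is q :: _ then lt_eps e x (Some q.1) else false.

Fixpoint ins e s x : seq (X * node) * (nat * nat) :=
  let d := endline (boxes s) (e (+) par x) 0 in
  if s is (z, c) :: s' then
    if lt_eps e x (Some z) then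
      let: (t, a) := ins e s' x in
      let: (d, b) := local_rule (e (+) par z) (boxes s') a c in
      ((z, d) :: t, b)
    else ((x, d) :: s, d)
  else ((x, d) :: s, d).

Lemma std_trans : transitive std_lt.
Proof.
move=> q p r; rewrite /std_lt => /orP[h|/andP[/eqP-> h]] /orP[h'|/andP[/eqP<- h']].
- by rewrite (lt_trans h h').
- by rewrite h.
- by rewrite h'.
- by rewrite eqxx (ltn_trans h h') orbT.
Qed.

Lemma std_irr : irreflexive std_lt.
Proof. by move=> p; rewrite /std_lt ltxx ltnn andbF. Qed.

Lemma std_le p q : std_lt p q -> p.1 <= q.1.
Proof. by case/orP => [/ltW//|/andP[/eqP-> _]]. Qed.

Lemma growth_young s : growth s -> young (boxes s).
Proof. by case: s => [_|p s [_ [_ _ yc] _]] //=; apply: young0. Qed.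

Lemma ins_place e s x : before e x s = false ->
  ins e s x = ((x, endline (boxes s) (e (+) par x) 0) :: s,
               endline (boxes s) (e (+) par x) 0).
Proof. by case: s => [|[z c] s] //= ->. Qed.

Lemma ins_boxes e s x : growth s ->
  addable (boxes s) (ins e s x).2 /\
  boxes (ins e s x).1 = (ins e s x).2 |` boxes s.
Proof.
elim: s => [_|[z c] s IHs] /=.
  by split=> //; apply: endline0_addable; apply: young0.
move=> [/IHs[]]; case: ifP => [_|_ _ _ [_ _ yc] _]; last first.
  by split=> //; apply: endline0_addable.
case: (ins e s x) => t a /= aD tE cD _.
have := local_rule_shape (e (+) par z) (boxes s) a c.
have [] := local_rule_addable (e (+) par z) aD cD.
by case: (local_rule _ _ _ _) => d b /= _ bD <-; rewrite tE.
Qed.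

Lemma before_std_lt e D c d x h :
  addable D c -> addable (c |` D) d -> coord (e (+) par x) d = 0%N ->
  ~~ lt_eps e x (Some h) = std_lt (h, c) (x, d).
Proof.
move=> cD dD d0; rewrite /std_lt /=; case: (ltgtP h x) => [hx|hx|hx] /=.
- by case: e d0.
- by case: e d0.
subst h; case: e d0 => /= d0; last first.
  by rewrite (addable_dichotomy _ cD dD) negbK d0.
by rewrite d0.
Qed.

Lemma std_lt_local_rule e D c d x z :
  addable D c -> addable D d -> coord (e (+) par x) d = 0%N ->
  lt_eps e x (Some z) = std_lt (x, d) (z, (local_rule (e (+) par z) D d c).1).
Proof.
move=> cD dD d0; rewrite /std_lt /=; case: (ltgtP x z) => [xz|xz|xz] /=.
- by case: e d0.
- by case: e d0.
subst z; have := coord_local_rule0 cD dD d0.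
rewrite (local_ruleC _ _ d) /=; have [] := local_rule_addable (e (+) par x) dD cD.
case: (local_rule _ _ _ _) => d' b /= dD' _.
case: e d0 => /= [->//|d0]; rewrite (addable_dichotomy _ dD dD') negbK d0; lia.
Qed.

(* From right to left, this shows that insertion preserves growths; from left to
   right, that the inverse of the local rules does. *)
Lemma ins_std_lt_head e s x z c : growth s -> addable (boxes s) c ->
  let: (t, a) := ins e s x in
  std_lt_head (z, (local_rule (e (+) par z) (boxes s) a c).1) t =
  lt_eps e x (Some z) && std_lt_head (z, c) s.
Proof.
move=> gs cs; case: (boolP (before e x s)) => [|/negPf xs].
  case: s gs cs => [|[h ch] s] //= [gs chs _] cs xh; rewrite xh.
  have [aD tE] := ins_boxes e x gs; case: (ins e s x) aD tE => t a /= aD tE.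
  have := local_rule_mono_iff (~~ par h) (e (+) par h) aD chs cs.
  case: (local_rule _ _ _ _) => d b mono; rewrite /= /std_lt /=.
  case: (ltgtP h z) => [hz|hz|hz]; last by subst z; rewrite mono xh.
    rewrite /= andbT; apply/esym.
    by move: xh; case: (e) => /= [/le_trans->|/lt_trans->] //; apply: ltW.
  by rewrite andbF.
rewrite (ins_place xs) /=; set d := endline _ _ _.
have dD : addable (boxes s) d by apply: endline0_addable; apply: growth_young.
have d0 : coord (e (+) par x) d = 0%N by apply: coord_endline.
rewrite -(std_lt_local_rule z cs dD d0); apply/esym/andb_idr => xz.
(* Here [x] sits between the head of [s] and [z], and for either [e] one of the two comparisons is
   strict. *)
case: s gs xs {cs d dD d0} => [|[h ch] s] //= [gs chs _] xh.
suff hz : h < z by rewrite /std_lt /= hz.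
case: (e) xh xz => /= xh xz; first by rewrite (lt_le_trans _ xz)// ltNge xh.
by rewrite (le_lt_trans _ xz)// leNgt xh.
Qed.

Lemma ins_growth e s x : growth s -> growth (ins e s x).1.
Proof.
elim: s => [|[z c] s IHs].
  by move=> _ /=; split=> //; apply: endline0_addable; apply: young0.
move=> gs; case: (boolP (before e x ((z, c) :: s))) => [/= xz|/negPf xs]; last first.
  rewrite ins_place //; split=> //.
    by apply: endline0_addable; apply: growth_young.
  case: gs => gs cs _ /=; rewrite -(before_std_lt _ cs _ (coord_endline _ _ _)).
    exact/negbT.
  by apply: endline0_addable; case: cs.
case: gs => gs cs zs; rewrite xz.
have := ins_std_lt_head e x z gs cs; have [] := ins_boxes e x gs.
case: (ins e s x) (IHs gs) => t a /= gt aD tE; rewrite xz zs.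
have [] := local_rule_addable (e (+) par z) aD cs.
by case: (local_rule _ _ _ _) => d b /= dD _ ht; split=> //; rewrite tE.
Qed.

Lemma ins_letters e s x :
  perm_eq (map fst (ins e s x).1) (x :: map fst s).
Proof.
elim: s => [|[z c] s IHs] //=; case: ifP => // _.
case: (ins e s x) IHs => t a /= IHs; case: (local_rule _ _ _ _) => d b /=.
rewrite -(perm_cons z) in IHs; apply: perm_trans IHs _.
exact/permPl/(perm_catCA [:: z] [:: x] (map fst s)).
Qed.

(** The local rules are undone from the last box of the growth downwards, [b] being the box still to
    be removed. *)
Lemma ins_surj e t b : growth t -> b \in boxes t -> young (boxes t `\ b) ->
  exists s x, [/\ growth s, ins e s x = (t, b) & boxes s = boxes t `\ b].
Proof.
elim: t b => [|[z d] t IHt] b; first by rewrite inE.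
move=> /= [gt dt zt] bt yb; have yt := growth_young gt.
have dnt : d \notin boxes t by case: dt.
(* For [b] different from [d] the rule kept both boxes, so [b] is passed on unchanged. *)
case: (eqVneq b d) => [bd|bd]; last first.
  have bt' : b \in boxes t by move: bt; rewrite !inE (negPf bd).
  have shE : (d |` boxes t) `\ b = d |` (boxes t `\ b).
    by rewrite fsetDUl mem_fsetD1 // !inE.
  have yb' : young (boxes t `\ b).
    have -> : boxes t `\ b = ((d |` boxes t) `\ b) `&` boxes t.
      by apply/fsetP=> u; rewrite !inE; case: (u \in boxes t);
        rewrite ?orbT ?andbF ?andbT.
    exact: youngI.
  have [s [x [gs insE sE]]] := IHt _ gt bt' yb'.
  exists ((z, d) :: s), x.
  have ds : addable (boxes s) d.
    rewrite sE; split=> //; first by rewrite !inE (negPf dnt) andbF.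
    by rewrite -shE.
  have locE : local_rule (e (+) par z) (boxes s) b d = (d, b).
    by rewrite /local_rule (negPf bd).
  (* This yields both that [x] passes [z] and that [(z, d)] extends the recovered growth. *)
  have := ins_std_lt_head e x z gs ds; rewrite insE locE /= zt => /esym/andP[xz zs].
  by split=> //=; rewrite ?xz ?insE ?locE ?sE.
subst b; case: (posnP (coord (e (+) par z) d)) => d0.
  exists t, z; rewrite fsetU1K //; split=> //.
  have dE : endline (boxes t) (e (+) par z) 0 = d by rewrite -d0 addable_endline.
  rewrite ins_place ?dE //; case: t gt dt zt {IHt bt yb yt dnt dE} => [|[h c] t] //=.
  move=> [_ ct _] dt; rewrite -(before_std_lt h ct dt d0); exact: negPf.
have [c ct [cD cE]] := bump_node_surj dt d0.
have yc : young (boxes t `\ c) by case: cD.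
have [s [x [gs insE sE]]] := IHt _ gt ct yc.
exists ((z, c) :: s), x; rewrite -sE in cD cE.
have locE : local_rule (e (+) par z) (boxes s) c c = (d, d).
  by rewrite /local_rule eqxx cE.
have := ins_std_lt_head e x z gs cD; rewrite insE locE /= zt => /esym/andP[xz zs].
split; first by split.
  by rewrite /= xz insE locE.
by rewrite fsetU1K //= sE fsetD1K.
Qed.

Lemma ins_inj e s s' x x' : growth s -> growth s' ->
  ins e s x = ins e s' x' -> s = s' /\ x = x'.
Proof.
elim: s s' => [|[z c] s IHs] s' gs gs' E.
  have := ins_letters e s' x'; rewrite -E => /perm_size /=.
  by case: s' E {gs'} => //= -[].
case: s' gs' E => [|[z' c'] s'] gs' E.
  by have := ins_letters e ((z, c) :: s) x; rewrite E => /perm_size.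
have sh : boxes (ins e ((z, c) :: s) x).1 = boxes (ins e ((z', c') :: s') x').1.
  by rewrite E.
move: E sh; rewrite /=; case: ifP => xz; case: ifP => xz'; last first.
- by move=> [-> _ -> -> ->].
- case: gs' => gs' cs' _; have [aD _] := ins_boxes e x' gs'.
  case: (ins e s' x') aD => t a /= aD.
  case locE: (local_rule _ _ _ _) => [d b] [E1 E2 _ E3] _; subst z' d b.
  move: locE; rewrite /local_rule.
  case: eqP => [_ [E4 _]|ne [E4 E5]]; last by case: ne; rewrite E4 -E5.
  by have := coord_bump_node (boxes s') (e (+) par x) c'; rewrite E4 coord_endline.
- case: gs => gs cs _; have [aD _] := ins_boxes e x gs.
  case: (ins e s x) aD => t a /= aD.
  case locE: (local_rule _ _ _ _) => [d b] [E1 E2 _ E3] _; subst z d b.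
  move: locE; rewrite /local_rule.
  case: eqP => [_ [E4 _]|ne [E4 E5]]; last by case: ne; rewrite E4 -E5.
  by have := coord_bump_node (boxes s) (e (+) par x') c; rewrite E4 coord_endline.
case: gs gs' => [gs cs _] [gs' cs' _].
have [aD tE] := ins_boxes e x gs; have [aD' tE'] := ins_boxes e x' gs'.
have := IHs s' gs gs'.
case: (ins e s x) aD tE => t a /= aD tE.
case: (ins e s' x') aD' tE' => t' a' /= aD' tE' IH.
case locE: (local_rule _ _ _ _) => [d b]; case locE': (local_rule _ _ _ _) => [d' b'].
move=> [E1 E2 E3 E4] _; subst z' d' t' b'.
(* The rule returns equal boxes exactly when it bumps, so the outputs reveal the branch and then the
   inputs. *)
suff [E1 E2] : a = a' /\ c = c' by subst; have [-> ->] := IH erefl.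
move: locE locE'; rewrite /local_rule.
case: eqP => [ac|ac] [] db1 db2; case: eqP => [ac'|ac'] [] db1' db2'.
- subst a a'; suff : c = c' by [].
  by apply: (bump_node_inj (q := e (+) par z) cs cs'); rewrite -?tE // db1.
- by case: ac'; rewrite db1' db2' -db1 db2.
- by case: ac; rewrite db1 db2 -db1' db2'.
- by split; [rewrite db2 | rewrite db1].
Qed.

(* [(x, z)] may be followed by [(y, z)] with [par z = e] in an ordered
   restricted biword. *)
Definition prec_eps e x y : bool :=
  prec par x y || (x == y) && ~~ (par x (+) e).

Lemma place_prec_eps e D c d x y :
  addable D c -> addable (c |` D) d -> coord (e (+) par y) d = 0%N ->
  ~~ lt_eps e y (Some x) ->
  (coord (~~ e) c < coord (~~ e) d)%N = prec_eps e x y.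
Proof.
move=> cD dD d0 yx.
have -> : (coord (~~ e) c < coord (~~ e) d)%N = ~~ par y.
  case py: (par y) d0; rewrite ?addbT ?addbF => d0; first by rewrite d0.
  by rewrite (addable_dichotomy _ cD dD) negbK d0.
rewrite /prec_eps /prec; move: yx; case: (ltgtP x y) => [xy|xy|<-].
- by case: (par x); case: (par y); rewrite ?orbF.
- by case: (e) => /=; rewrite ?xy // ltW.
- by case: (e) => /=; rewrite ?lexx //; case: (par x).
Qed.

Lemma local_rule_prec_eps e D a d x y :
  addable D d -> addable D a -> coord (e (+) par x) d = 0%N ->
  lt_eps e y (Some x) ->
  (coord (~~ e) d < coord (~~ e) (local_rule (e (+) par x) D a d).2)%N =
  prec_eps e x y.
Proof.
move=> dD aD d0 yx; have [_] := local_rule_addable (e (+) par x) aD dD.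
have := coord_local_rule0 aD dD d0; move: (local_rule _ _ _ _).2 => b b0 bD.
have -> : (coord (~~ e) d < coord (~~ e) b)%N = par x.
  case px: (par x) d0 b0; rewrite ?addbT ?addbF => d0 b0; first by rewrite d0 b0.
  by rewrite (addable_dichotomy _ dD bD) negbK d0 leqNgt b0.
rewrite /prec_eps /prec; move: yx; case: (ltgtP x y) => [xy|xy|<-].
- by case: (e) => /=; [rewrite leNgt xy | rewrite ltNge (ltW xy)].
- by case: (par x); case: (par y).
- by case: (e) => /=; rewrite ?ltxx //; case: (par x).
Qed.

(** While both letters pass a box of the growth, [local_rule_mono_iffV] preserves the comparison.
    This reduces to the level where one of them is placed, which the two preceding lemmas treat. *)
Lemma ins_prec_eps e s x y : growth s ->
  let: (t, a) := ins e s x in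
  (coord (~~ e) a < coord (~~ e) (ins e t y).2)%N = prec_eps e x y.
Proof.
have place s' : growth s' -> before e x s' = false ->
    let: (t, a) := ins e s' x in
    (coord (~~ e) a < coord (~~ e) (ins e t y).2)%N = prec_eps e x y.
  move=> gs' xs'; have yo := growth_young gs'; rewrite ins_place //.
  have := @endline0_addable _ (e (+) par x) yo.
  have := coord_endline (boxes s') (e (+) par x) 0.
  move: (endline _ _ _) => d d0 dD /=; case: ifP => yx.
    have [aD _] := ins_boxes e y gs'; have := local_rule_prec_eps dD aD d0 yx.
    by case: (ins e s' y) => t a /=; case: (local_rule _ _ _ _).
  apply: (place_prec_eps dD); rewrite ?coord_endline //; last exact/negbT.
  by apply: endline0_addable; case: dD.
elim: s => [|[z c] s IHs] gs; first exact: (place [::]).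
case xs: (before e x ((z, c) :: s)); last exact: place.
move: xs => /= xz; rewrite xz; case: gs => gs cs zs.
have [aD tE] := ins_boxes e x gs; have [] := ins_boxes e y (ins_growth e x gs).
have := IHs gs.
case: (ins e s x) aD tE => t a /= aD tE IH; rewrite tE => a2D _.
have := local_rule_mono_iffV (~~ e) (e (+) par z) cs aD.
have [] := local_rule_addable (e (+) par z) aD cs.
have := local_rule_shape (e (+) par z) (boxes s) a c.
case: (local_rule _ _ _ _) => d b /= shE dD bD mono.
case: ifP => yz.
  rewrite -IH -(mono _ a2D) -tE.
  by case: (ins e t y) => t2 a2 /=; case: (local_rule _ _ _ _).
have dE : addable (b |` (c |` boxes s)) (endline (d |` boxes t) (e (+) par y) 0).
  by rewrite -shE -tE; apply: endline0_addable; rewrite tE; case: dD.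
apply: (place_prec_eps bD dE); first exact: coord_endline.
(* Since [x] passes [z] and [y] does not, [y] cannot come before [x]. *)
apply: contraFN yz => yx; move: yx xz; case: (e) => /= yx xz.
  exact: le_trans yx xz.
exact: lt_trans yx xz.
Qed.

End Growth.

(** * Growths and tableaux *)

Section Bridge.

Context {disp : Order.disp_t} {X : orderType disp} (par : X -> bool).
Implicit Types (s t : seq (X * node)) (x y z h : X) (e : bool).
Implicit Types (T S : tableau X) (a b c d u v : nat * nat).

Fixpoint tab_of s : tableau X :=
  if s is (z, c) :: s' then (tab_of s').[c <- z] else [fmap].

Lemma domf_tab s : domf (tab_of s) = boxes s.
Proof. by elim: s => [|[z c] s IHs] //=; rewrite IHs. Qed.

Lemma fnd_tab_mem s u y : (tab_of s).[? u] = Some y -> (y, u) \in s.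
Proof.
elim: s => [|[z c] s IHs] /=; first by rewrite fnd_fmap0.
rewrite fnd_set inE; case: eqP => [-> [->]|_ /IHs->]; first by rewrite eqxx.
by rewrite orbT.
Qed.

Lemma mem_boxes s p : p \in s -> p.2 \in boxes s.
Proof.
elim: s => [|q s IHs] //=; rewrite !inE => /orP[/eqP->|/IHs->]; rewrite ?eqxx ?orbT//.
Qed.

Lemma mem_fnd_tab s p : growth par s -> p \in s -> (tab_of s).[? p.2] = Some p.1.
Proof.
elim: s => [|[z c] s IHs] //= [gs [_ cs _] _]; rewrite inE => /orP[/eqP->|ps].
  by rewrite fnd_set eqxx.
rewrite fnd_set ifN ?IHs //; apply: contraNneq cs => <-; exact: mem_boxes.
Qed.

Lemma growth_sorted s : growth par s -> sorted (fun p q => std_lt par q p) s.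
Proof.
elim: s => [|p s IHs] //= [/IHs + _ hs]; by case: s hs {IHs} => //= q s -> ->.
Qed.

Lemma std_rev_trans : transitive (fun p q => std_lt par q p).
Proof. by move=> q p r pq qr; apply: std_trans qr pq. Qed.

Lemma growth_std_lt p s q : growth par (p :: s) -> q \in s -> std_lt par q p.
Proof.
by move=> /growth_sorted/(order_path_min std_rev_trans)/allP/[apply].
Qed.

(** Successive equal letters advance strictly in direction [~~ par z], hence go weakly back in
    direction [par z] by [addable_dichotomy]. *)
Lemma growth_weak z c s b : growth par ((z, c) :: s) -> (z, b) \in s ->
  (coord (par z) c <= coord (par z) b)%N.
Proof.
elim: s c => [|[h ch] s IHs] c //= [[gs chs hs] cs std_h].
have adj : h = z -> (coord (par z) c <= coord (par z) ch)%N.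
  move=> hz; subst h; move: std_h.
  by rewrite /std_lt /= ltxx eqxx (addable_dichotomy _ chs cs) negbK.
rewrite inE => /orP[/eqP[/esym zh ->]|zs]; first exact: adj.
have zh : h = z.
  have ghs : growth par ((h, ch) :: s) by [].
  have := std_le (growth_std_lt ghs zs); have := std_le std_h.
  by move=> /= h1 h2; apply/le_anti; rewrite h1 h2.
apply: leq_trans (adj zh) _; subst h; exact: IHs.
Qed.

(** A growth is the list of entries of its tableau sorted by a strict order. *)
Lemma growth_inj s s' :
  growth par s -> growth par s' -> tab_of s = tab_of s' -> s = s'.
Proof.
move=> gs gs' E.
apply: (irr_sorted_eq std_rev_trans) (growth_sorted gs) (growth_sorted gs') _.
  exact: std_irr.
move=> p; apply/idP/idP => ps.
  by have := mem_fnd_tab gs ps; rewrite E => /fnd_tab_mem; case: (p).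
by have := mem_fnd_tab gs' ps; rewrite -E => /fnd_tab_mem; case: (p).
Qed.

(** Bumping paths without fuel, for induction along the path. *)
Inductive ispath T e : X -> nat -> seq (node * X) -> Prop :=
| Path_stop x i : T.[? landing par T e x i] = None ->
    ispath T e x i [:: (landing par T e x i, x)]
| Path_step x i y p : T.[? landing par T e x i] = Some y ->
    ispath T e y (coord (e (+) par y) (landing par T e x i)).+1 p ->
    ispath T e x i ((landing par T e x i, x) :: p).

Lemma ispath_eq T e x i p p' : ispath T e x i p -> ispath T e x i p' -> p = p'.
Proof.
move=> P; elim: P p' => {x i p} [x i TN|x i y p Ty _ IH] p' P'.
  by inversion P'; subst => //; congruence.
inversion P'; subst; first by congruence.
have yy : y0 = y by congruence.
by subst y0; rewrite (IH p0).
Qed.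

Lemma bump_path_ispath T e n x i :
  last (0, 0)%N [seq p.1 | p <- bump_path par T e n x i] \notin domf T ->
  ispath T e x i (bump_path par T e n x i).
Proof.
elim: n x i => [|n IHn] x i /=.
  case Ty: (T.[? landing par T e x i]) => [y|] /=.
    by rewrite -fndSome Ty.
  by move=> _; constructor.
case Ty: (T.[? landing par T e x i]) => [y|] /= lastT; last by constructor.
apply: (Path_step Ty); apply: IHn.
by case: n lastT => [|n] /=.
Qed.

Lemma insertion_pathE T e x p : ispath T e x 0 p -> insertion_path par T e x = p.
Proof.
apply: ispath_eq; apply: bump_path_ispath; exact: added_nodeP.
Qed.

Lemma ispath_mem T e x i p b : ispath T e x i p -> b \in map fst p ->
  (b \in domf T) || (b == last (0, 0)%N (map fst p)).
Proof.
elim=> {x i p} [x i _|x i y p Ty P IH] /=; rewrite inE.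
  by move=> /eqP->; rewrite eqxx orbT.
move=> /orP[/eqP->|/IH]; first by rewrite -fndSome Ty.
by case: P {IH}.
Qed.

Lemma ispath_last_mem T e x i p :
  ispath T e x i p -> last (0, 0)%N (map fst p) \in map fst p.
Proof. by case=> [? ? _|? ? ? ? _ _] /=; [rewrite inE | apply: mem_last]. Qed.

Lemma landing_eq T S e y i :
  (forall u, coord (e (+) par y) u = i -> lt_eps e y T.[? u] = lt_eps e y S.[? u]) ->
  landing par T e y i = landing par S e y i.
Proof.
move=> TS; rewrite /landing; congr line_node; apply: eq_ex_minn => k.
by rewrite TS // coord_line.
Qed.

Lemma landing_endline T e x i :
  (forall u y, coord (e (+) par x) u = i -> T.[? u] = Some y ->
     ~~ lt_eps e x (Some y)) ->
  landing par T e x i = endline (domf T) (e (+) par x) i.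
Proof.
move=> Tx; rewrite /landing /endline; congr line_node; apply: eq_ex_minn => k.
rewrite -fndSome; case Tk: (T.[? _]) => [y|] //=.
by apply/negbTE; apply: Tx Tk; rewrite coord_line.
Qed.

(** The alternative on [x], [z] and [i] says that [c] receives the current letter as readily when it
    holds the largest entry [z] as when it is empty. So the path is unchanged until it stops; if it
    stops at [c], it goes on with one bump of [z]. *)
Lemma ispath_set s z c e x i p : growth par ((z, c) :: s) ->
  ispath (tab_of s) e x i p ->
  lt_eps e x (Some z) \/ x = z /\ (coord (e (+) par z) c < i)%N ->
  ispath (tab_of s).[c <- z] e x i
    (p ++ if last (0, 0)%N (map fst p) == c
          then [:: (bump_node (boxes s) (e (+) par z) c, z)] else [::]).
Proof.
move=> gs P; have gs' : growth par s by case: gs.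
have cs : c \notin domf (tab_of s) by rewrite domf_tab; case: gs => _ [].
have land y j : lt_eps e y (Some z) \/ y = z /\ (coord (e (+) par z) c < j)%N ->
    landing par (tab_of s).[c <- z] e y j = landing par (tab_of s) e y j.
  move=> yz; apply: landing_eq => u uj; rewrite fnd_set; case: eqP => // uc; subst u.
  rewrite (not_fnd cs); case: yz => // -[yz ltj]; subst y; lia.
elim: P => {x i p} [x i SN|x i y p Sy P IH] xz; rewrite -(land x i xz) /=.
  case: eqP => [Lc|Lc]; last first.
    by move/eqP/negPf: Lc => Lc; apply: Path_stop; rewrite fnd_set Lc (land x i xz).
  apply: (Path_step (y := z)); first by rewrite fnd_set Lc eqxx.
  (* No entry of the next line can be displaced by [z]: for [e] odd, an equal entry there would
     follow [c] in the standardization order. *)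
  rewrite Lc; have LE : landing par (tab_of s).[c <- z] e z (coord (e (+) par z) c).+1
      = bump_node (boxes s) (e (+) par z) c.
    rewrite landing_endline ?dom_setf ?domf_tab // => u y uc.
    move=> /(@fnd_tab_mem ((z, c) :: s)).
    rewrite inE => /orP[/eqP[_ uc']|us]; first by rewrite uc' in uc; lia.
    have := growth_std_lt gs us; rewrite /std_lt /=; case: (ltgtP y z) => //= [yz _|yz].
      by case: (e).
    by subst y; case: (e) uc => //= ->; lia.
  rewrite -LE; apply: Path_stop; rewrite LE; apply: not_fnd.
  by rewrite -[_ \in _]/(_ \in domf (tab_of ((z, c) :: s))) domf_tab endline_notin.
have yS := fnd_tab_mem Sy; have std_y := growth_std_lt gs yS.
have -> : last (landing par (tab_of s).[c <- z] e x i) (map fst p)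
    = last (0, 0)%N (map fst p).
  by case: P.
apply: (Path_step (y := y)).
  rewrite fnd_set (land x i xz) ifN ?Sy //; apply: contraNneq cs => <-.
  by rewrite -fndSome Sy.
rewrite (land x i xz); apply: IH.
(* The displaced [y] satisfies the alternative again; if [y = z] and [e] is even, [growth_weak] puts
   its next line beyond that of [c]. *)
move: std_y; rewrite /std_lt /= => /orP[yz|/andP[/eqP yz cu]].
  by left; case: (e); rewrite //= ltW.
subst y; case: (e) yS => yS; [by left; rewrite /= lexx|right].
by split=> //; rewrite ltnS !addFb; exact: growth_weak gs yS.
Qed.

Definition set_all T (p : seq (node * X)) : tableau X :=
  foldl (fun S q => S.[q.1 <- q.2]) T p.

Lemma fnd_set_all_notin T p u : u \notin map fst p -> (set_all T p).[? u] = T.[? u].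
Proof.
elim: p T => [|[b y] p IHp] T //=; rewrite inE negb_or => /andP[ub up].
by rewrite IHp // fnd_set (negPf ub).
Qed.

Lemma fnd_set_all_in T S p u : u \in map fst p ->
  (set_all T p).[? u] = (set_all S p).[? u].
Proof.
elim: p T S => [|[b y] p IHp] T S //=; case: (boolP (u \in map fst p)) => up.
  by move=> _; apply: IHp.
rewrite inE (negPf up) orbF => /eqP ub.
by rewrite !fnd_set_all_notin // !fnd_set ub eqxx.
Qed.

(** Restoring the largest entry prolongs the path exactly when it ended at that entry's box, by
    [ispath_set]; these are the two branches of [local_rule]. *)
Lemma ins_tab_path e s x : growth par s ->
  exists2 p, ispath (tab_of s) e x 0 p &
    last (0, 0)%N (map fst p) = (ins par e s x).2 /\
    set_all (tab_of s) p = tab_of (ins par e s x).1.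
Proof.
elim: s => [|[z c] s IHs] gs.
  have LE : landing par (tab_of [::]) e x 0 = endline fset0 (e (+) par x) 0.
    by rewrite landing_endline // => u y _; rewrite fnd_fmap0.
  exists [:: (landing par (tab_of [::]) e x 0, x)].
    by apply: Path_stop; rewrite fnd_fmap0.
  by rewrite /= LE.
have gs' : growth par s by case: gs.
case: (boolP (before e x ((z, c) :: s))) => [xz|xz]; last first.
  have LE : landing par (tab_of ((z, c) :: s)) e x 0
      = endline (boxes ((z, c) :: s)) (e (+) par x) 0.
    rewrite landing_endline ?domf_tab // => u y _ /fnd_tab_mem.
    rewrite inE => /orP[/eqP[-> _] //|us].
    have := std_le (growth_std_lt gs us) => /= yz; apply: contra xz => /=.
    by case: (e) => xy; [apply: le_trans xy yz|apply: lt_le_trans xy yz].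
  exists [:: (landing par (tab_of ((z, c) :: s)) e x 0, x)].
    apply: Path_stop; rewrite LE not_fnd //.
    rewrite -[_ \in _]/(_ \in domf (tab_of ((z, c) :: s))).
    by rewrite domf_tab endline_notin.
  by rewrite ins_place ?(negPf xz) //= -LE.
have [p P [lastE setE]] := IHs gs'.
have := ispath_set gs P (or_introl xz).
rewrite lastE /= [if e then _ else _]xz.
have [aD _] := ins_boxes e x gs'.
case: (ins par e s x) lastE setE aD => t a /= lastE setE aD.
rewrite /local_rule; case: eqP => [ac|ac] /= Pz.
  exists (p ++ [:: (bump_node (boxes s) (e (+) par z) c, z)]) => //.
  rewrite map_cat last_cat /=; split=> //; rewrite /set_all foldl_cat /=.
  rewrite -setE; congr (_.[_ <- _]); apply/fmapP => u.
  (* The path visits [c], so the value written there beforehand is overwritten. *)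
  have cp : c \in map fst p by rewrite -ac -lastE (ispath_last_mem P).
  case: (boolP (u \in map fst p)) => up; first exact: fnd_set_all_in.
  rewrite !fnd_set_all_notin // fnd_set ifN //; apply: contraNneq up => ->; exact: cp.
exists p; first by move: Pz; rewrite cats0.
split=> //; rewrite -setE; apply/fmapP => u; rewrite fnd_set.
case: (boolP (u \in map fst p)) => up; last by rewrite !fnd_set_all_notin // fnd_set.
rewrite (fnd_set_all_in _ (tab_of s) up) ifN //.
apply/eqP => uc; subst u; have := ispath_mem P up; rewrite lastE domf_tab.
case: gs => _ [_ /negPf-> _] _ /= /eqP ca; exact: ac.
Qed.

Lemma insertion_tab e s x : growth par s ->
  insertion par (tab_of s) e x = tab_of (ins par e s x).1.
Proof.
move=> gs; have [p P [_ <-]] := ins_tab_path e x gs.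
by rewrite /insertion (insertion_pathE P).
Qed.

Lemma added_node_tab e s x : growth par s ->
  added_node par (tab_of s) e x = (ins par e s x).2.
Proof.
move=> gs; have [p P [<- _]] := ins_tab_path e x gs.
by rewrite /added_node (insertion_pathE P).
Qed.

(** * Contents and semistandardness of the tableaux of growths *)

Lemma uniq_boxes s : growth par s -> uniq (map snd s).
Proof.
elim: s => [|p s IHs] //= [gs [_ + _] _]; rewrite IHs // andbT.
by apply: contra => /mapP[q qs ->]; apply: mem_boxes.
Qed.

Lemma boxesE s u : (u \in boxes s) = (u \in map snd s).
Proof. by elim: s => [|p s IHs] //=; rewrite !inE IHs. Qed.

Lemma content_tab s : growth par s -> content (tab_of s) = seq_mset (map fst s).
Proof.
move=> gs; apply/eq_seq_msetP; set f := fun u => (tab_of s).[? u].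
have -> : codom (tab_of s) = pmap f (map val (enum {: domf (tab_of s)})).
  by rewrite codomE; elim: (enum _) => //= u r ->; rewrite /f in_fnd /= ; case: u.
have -> : map fst s = pmap f (map snd s).
  have : {in s, forall p, f p.2 = Some p.1} by move=> p; apply: mem_fnd_tab.
  elim: (s) => //= p r IHr pr; rewrite pr ?mem_head //= -IHr // => q qr.
  by apply: pr; rewrite inE qr orbT.
apply: perm_pmap; apply: uniq_perm; rewrite ?uniq_boxes //.
  by rewrite map_inj_uniq ?enum_uniq //; apply: val_inj.
move=> u; rewrite -boxesE -domf_tab; apply/mapP/idP => [[v _ ->]|uD]; first exact: valP.
by exists [` uD]; rewrite ?mem_enum.
Qed.

Lemma semistandardE T : semistandard par T <->
  (forall u v x y, T.[? u] = Some x -> T.[? v] = Some y ->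
     [/\ node_le u v -> x <= y,
         u <> v -> u.1 = v.1 -> x = y -> ~~ par x
       & u <> v -> u.2 = v.2 -> x = y -> par x]).
Proof.
split=> [[le_T row_T col_T] u v x y|].
  move=> /fndSomeP[uT <-] /fndSomeP[vT <-].
  split=> [uv|uv|uv].
  - exact: (le_T [` uT] [` vT]).
  - by apply: (row_T [` uT] [` vT]); apply/eqP => /(congr1 val).
  - by apply: (col_T [` uT] [` vT]); apply/eqP => /(congr1 val).
move=> H; split=> u v.
- by have [] := H _ _ _ _ (esym (Some_fnd u)) (esym (Some_fnd v)).
- move=> /eqP uv; have [_ + _] := H _ _ _ _ (esym (Some_fnd u)) (esym (Some_fnd v)).
  by apply=> /val_inj.
- move=> /eqP uv; have [_ _ +] := H _ _ _ _ (esym (Some_fnd u)) (esym (Some_fnd v)).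
  by apply=> /val_inj.
Qed.

Lemma growth_le s p q :
  growth par s -> p \in s -> q \in s -> node_le p.2 q.2 -> p.1 <= q.1.
Proof.
elim: s p q => [|r s IHs] p q // gs; have [gs' [yo rs _] _] := gs.
rewrite !inE => /orP[/eqP->|ps] /orP[/eqP->|qs] pq //; last exact: IHs.
  by rewrite (yo _ _ (mem_boxes qs) pq) in rs.
exact: std_le (growth_std_lt gs ps).
Qed.

Lemma growth_total s p q : growth par s -> p \in s -> q \in s -> p != q ->
  std_lt par p q || std_lt par q p.
Proof.
elim: s p q => [|r s IHs] p q // gs; have [gs' _ _] := gs.
rewrite !inE => /orP[/eqP->|ps] /orP[/eqP->|qs]; rewrite ?eqxx // => pq.
- by rewrite (growth_std_lt gs qs) orbT.
- by rewrite (growth_std_lt gs ps).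
- exact: IHs.
Qed.

(** Equal letters are comparable for [std_lt], so they differ in column if even and in row if
    odd. *)
Lemma semistandard_tab s : growth par s -> semistandard par (tab_of s).
Proof.
move=> gs; apply/semistandardE => u v x y /fnd_tab_mem us /fnd_tab_mem vs.
split=> [uv|uv uv' xy|uv uv' xy]; first exact: (growth_le gs us vs uv).
all: subst y; have : std_lt par (x, u) (x, v) || std_lt par (x, v) (x, u).
1,3: by apply: (growth_total gs us vs); apply/eqP => -[].
all: by rewrite /std_lt /= ltxx eqxx /=; case: (par x); rewrite //= uv' ltnn.
Qed.

Lemma std_maximal (r : seq (X * node)) : r != [::] ->
  exists2 p, p \in r & {in r, forall q, ~~ std_lt par p q}.
Proof.
elim: r => // p [_ _|q r /(_ isT)[m mr mmax] _].
  by exists p; rewrite ?mem_head // => q; rewrite inE => /eqP->; rewrite std_irr.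
case mp: (std_lt par m p).
  exists p; rewrite ?mem_head // => q'; rewrite inE => /orP[/eqP->|q'r].
    by rewrite std_irr.
  by apply: contra (mmax _ q'r); apply: std_trans mp.
exists m; first by rewrite inE mr orbT.
by move=> q'; rewrite inE => /orP[/eqP->|]; [rewrite mp | apply: mmax].
Qed.

(** Semistandardness separates equal letters by their coordinate [~~ par z], so a maximal entry for
    [std_lt] is the largest one, and it occupies a corner. *)
Lemma semistandard_maximal T : semistandard par T -> domf T != fset0 ->
  exists z c, T.[? c] = Some z /\
    forall y v, T.[? v] = Some y -> v != c ->
      std_lt par (y, v) (z, c) /\ ~~ node_le c v.
Proof.
move=> /semistandardE sT T0.
have [[z c]] : exists2 p, T.[? p.2] = Some p.1 &
    forall q, T.[? q.2] = Some q.1 -> ~~ std_lt par p q.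
  have [u uT] : exists u, u \in domf T by apply/fset0Pn.
  have rP q : (q \in [seq (T w, val w) | w <- enum {: domf T}]) <->
      T.[? q.2] = Some q.1.
    split=> [/mapP[w _ ->] /=|/fndSomeP[vT qE]]; first by rewrite -Some_fnd.
    apply/mapP; exists [` vT]; first by rewrite mem_enum.
    by rewrite /= qE; case: (q).
  have [|p /rP pT pmax] := @std_maximal [seq (T w, val w) | w <- enum {: domf T}].
    apply/eqP => r0; have := rP (T [` uT], u); rewrite r0 /= in_fnd.
    by case=> _ /(_ erefl).
  by exists p => // q /rP; apply: pmax.
move=> /= cT cmax; exists z, c; split=> // y v vT vc.
have := cmax (y, v) vT; rewrite /std_lt /=.
have [le_zy row col] := sT _ _ _ _ cT vT.
have cv : c <> v by apply/eqP; rewrite eq_sym.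
have nle : coord (~~ par z) c = coord (~~ par z) v -> z <> y.
  move: row col; case: (par z) => /= row col /[swap] zy.
    by move=> h; have := row cv h zy.
  by move=> h; have := col cv h zy.
case: (ltgtP y z) nle => [yz|//|<-] nle /=.
  by split=> //; apply/negP => /le_zy; rewrite leNgt yz.
rewrite -leqNgt => le_vc; have ne_vc : coord (~~ par y) c != coord (~~ par y) v.
  by apply/eqP => /nle.
split; first by rewrite ltn_neqAle eq_sym ne_vc.
by rewrite (node_leE (~~ par y)) leqNgt ltn_neqAle eq_sym ne_vc le_vc.
Qed.

(** The growth is found from its head by removing the largest entry repeatedly. *)
Lemma semistandard_ex_growth T : semistandard par T -> young (domf T) ->
  exists2 s, growth par s & tab_of s = T.
Proof.
move: {2}#|` domf T| (leqnn #|` domf T|) => n.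
elim: n T => [|n IHn] T; case: (eqVneq (domf T) fset0) => [T0 _ _ _|T0].
1,3: exists [::] => //; apply/fmapP => u; rewrite fnd_fmap0 not_fnd //.
1,2: by rewrite -[_ \in _]/(_ \in domf T) T0.
  by rewrite leqn0 cardfs_eq0 (negPf T0).
move=> len sT yT; have [z [c [Tc cmax]]] := semistandard_maximal sT T0.
have cT : c \in domf T by rewrite -fndSome Tc.
have dS : domf T.[~ c] = domf T `\ c by rewrite domf_rem.
have yS : young (domf T.[~ c]).
  rewrite dS => u v; rewrite !inE => /andP[vc vT] uv; rewrite (yT _ _ vT uv) andbT.
  have [y Tv] : exists y, T.[? v] = Some y by exists T.[vT]; rewrite in_fnd.
  apply/eqP => uc; subst u.
  by have [_] := cmax _ _ Tv vc; rewrite uv.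
have sS : semistandard par T.[~ c].
  move: sT => /semistandardE sT; apply/semistandardE => u v x y.
  by rewrite !fnd_rem1; case: ifP => // _ Tu; case: ifP => // _; apply: sT.
have [|s gs sE] := IHn _ _ sS yS.
  by rewrite dS -ltnS (leq_trans _ len) // [leqRHS](cardfsD1 c) cT.
exists ((z, c) :: s); last first.
  by apply/fmapP => u /=; rewrite fnd_set sE fnd_rem1; case: eqP => [->|].
have bS : boxes s = domf T `\ c by rewrite -domf_tab sE.
split; first exact: gs.
  rewrite bS; apply: addable_rem => //; rewrite -dS; exact: yS.
case: s gs sE {bS} => [//|[h d] s] gs sE.
have := mem_fnd_tab gs (mem_head _ _); rewrite sE fnd_rem1 /=.
by case: ifP => // /eqP dc Td; have [] := cmax _ _ Td; first exact/eqP.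
Qed.

End Bridge.

(** * Growths and biwords *)

Section Words.

Context {dX dY : Order.disp_t} {X : orderType dX} {Y : orderType dY}.
Context (parX : X -> bool) (parY : Y -> bool).
Implicit Types (b c : X * Y) (w : seq (X * Y)).

(** Order and restriction combined in one transitive relation, so that both can be tested on
    neighbours only. *)
Definition biletter_next b c : bool :=
  (b.2 < c.2) || (b.2 == c.2) && prec_eps parX (parY c.2) b.1 c.1.

(* [w] is read from right to left: its head is the last biletter inserted. *)
Fixpoint rsk w : seq (X * node) * seq (Y * node) :=
  if w is b :: w' then
    let st := rsk w' in
    let ta := ins parX (parY b.2) st.1 b.1 in
    (ta.1, (b.2, ta.2) :: st.2)
  else ([::], [::]).

Lemma rsk_growth1 w : growth parX (rsk w).1.
Proof. by elim: w => //= b w IHw; apply: ins_growth. Qed.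

Lemma rsk_boxes w : boxes (rsk w).1 = boxes (rsk w).2.
Proof.
elim: w => //= b w IHw.
by have [_ ->] := ins_boxes (parY b.2) b.1 (rsk_growth1 w); rewrite IHw.
Qed.

(** Within a run of equal right letters [y], the recording growth compares boxes in direction
    [~~ parY y], as [ins_prec_eps] does for [e = parY y]. *)
Lemma rsk_growth2 w :
  growth parY (rsk w).2 <-> sorted (fun b c => biletter_next c b) w.
Proof.
have headE b c w' : std_lt_head parY
    (b.2, (ins parX (parY b.2) (rsk (c :: w')).1 b.1).2)
    (rsk (c :: w')).2 = biletter_next c b.
  rewrite /= /std_lt /biletter_next /=; case: eqP => // <-.
  have := ins_prec_eps (parY c.2) c.1 b.1 (rsk_growth1 w').
  by case: (ins _ _ _ _) => t a /= ->.
elim: w => [|b [|c w] IHw] //.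
  by split=> // _; split=> //; apply: endline0_addable; apply: young0.
split=> [[/IHw ws _ bc]|].
  by apply/andP; split=> //; rewrite -(headE b c w).
move=> /= /andP[bc /IHw ws]; rewrite -(headE b c w) in bc; split=> //.
have [bD _] := ins_boxes (parY b.2) b.1 (rsk_growth1 (c :: w)).
by rewrite rsk_boxes in bD.
Qed.

Lemma rsk_letters w :
  perm_eq (map fst (rsk w).1) (map fst w) /\ map fst (rsk w).2 = map snd w.
Proof.
elim: w => //= b w [IH1 ->]; split=> //.
by apply: perm_trans (ins_letters _ _ _ _) _; rewrite perm_cons.
Qed.

Lemma rsk_inj w w' : rsk w = rsk w' -> w = w'.
Proof.
elim: w w' => [|[x y] w IHw] [|[x' y'] w'] //= [E1 yy E2 E3]; subst y'.
have := ins_inj (e := parY y) (x := x) (x' := x') (rsk_growth1 w) (rsk_growth1 w').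
case: (ins _ _ _ x) E1 E2 => t a; case: (ins _ _ _ x') => t' a' /= -> ->.
move=> /(_ erefl)[E4 ->]; congr (_ :: _); apply: IHw.
by rewrite (surjective_pairing (rsk w)) E4 E3 -surjective_pairing.
Qed.

(** The last box of [t] tells which box of [s] to uninsert and with which [e]. *)
Lemma rsk_surj s t : growth parX s -> growth parY t -> boxes s = boxes t ->
  exists w, rsk w = (s, t).
Proof.
elim: t s => [|[y a] t IHt] s gs gt st.
  exists [::]; case: s st gs => //= p s /fsetP /(_ p.2).
  by rewrite !inE eqxx.
have [gt' [_ at_ _] _] := gt.
have as_ : a \in boxes s by rewrite st /= !inE eqxx.
have sE : boxes s `\ a = boxes t by rewrite st /= fsetU1K.
have ys : young (boxes s `\ a) by rewrite sE; apply: growth_young gt'.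
have [s' [x [gs' insE s'E]]] := ins_surj (parY y) gs as_ ys.
have [|w wE] := IHt s' gs' gt'; first by rewrite s'E.
by exists ((x, y) :: w); rewrite /= wE insE.
Qed.

Lemma sRSK_rsk k (w : k.-tuple (X * Y)) :
  sRSK parX parY w = (tab_of (rsk (rev w)).1, tab_of (rsk (rev w)).2).
Proof.
rewrite /sRSK -[in LHS](revK w) foldl_rev; elim: (rev w) => //= b r ->.
by rewrite /sRSK_step /= insertion_tab ?added_node_tab //; apply: rsk_growth1.
Qed.

Lemma biletter_nextE b c :
  biletter_next b c = biletter_le parX b c && ((b == c) ==> ~~ mixed parX parY b).
Proof.
rewrite /biletter_next /prec_eps /biletter_le /biletter_lt /mixed.
case: b c => [x y] [x' y'] /=; rewrite -pair_eqE /=.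
have irr : prec parX x x = false.
  by rewrite /prec ltxx; case: (parX x).
case: (ltgtP y y') => [yy|yy|<-] //=; rewrite ?andbF ?orbT //=.
case: (eqVneq x x') => [<-|xx] /=; rewrite ?irr /= ?orbF ?andbT //.
Qed.

Lemma biletter_next_trans : transitive biletter_next.
Proof.
have prec_trans : transitive (prec parX).
  move=> y x z; rewrite /prec.
  case: (parX x); case: (parX y); case: (parX z) => //=; rewrite ?orbF //.
    by move=> h1 h2; apply: lt_trans h2 h1.
  exact: lt_trans.
move=> [x' y'] [x y] [x'' y'']; rewrite /biletter_next /prec_eps /=.
move=> /orP[h1|/andP[/eqP-> h1]] /orP[h2|/andP[/eqP<- h2]].
- by rewrite (lt_trans h1 h2).
- by rewrite h1.
- by rewrite h2.
rewrite eqxx ltxx /=; case/orP: h1 => [h1|/andP[/eqP-> //]].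
case/orP: h2 => [h2|/andP[/eqP<- _]]; last by rewrite h1.
by rewrite (prec_trans _ _ _ h1 h2).
Qed.

Lemma ordered_restrictedP k (w : k.-tuple (X * Y)) :
  ordered parX w /\ restricted parX parY w <->
  sorted (fun b c => biletter_next c b) (rev w).
Proof.
rewrite rev_sorted (sorted_pairwise biletter_next_trans).
split=> [[ow rw]|].
  case: k w ow rw => [|k] w ow rw; first by rewrite tuple0.
  apply/(pairwiseP (tnth w ord0)) => i j; rewrite !inE size_tuple => ik jk ij.
  rewrite -[i]/(val (Ordinal ik)) -[j]/(val (Ordinal jk)) -!tnth_nth biletter_nextE.
  rewrite ow; last exact: ltnW.
  apply/implyP => /eqP E; apply: (rw _ (Ordinal jk)) E.
  by apply/eqP => -[ijE]; rewrite ijE ltnn in ij.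
case: k w => [|k] w; first by split; case.
move=> /(pairwiseP (tnth w ord0)) H.
have {}H (i j : 'I_k.+1) : (i < j)%N -> biletter_next (tnth w i) (tnth w j).
  move=> ij; rewrite (tnth_nth (tnth w ord0) w i) (tnth_nth (tnth w ord0) w j).
  by apply: H; rewrite ?inE ?size_tuple.
split=> i j.
  rewrite leq_eqVlt => /orP[/eqP/ord_inj->|/H].
    by rewrite /biletter_le eqxx.
  by rewrite biletter_nextE => /andP[].
have neq (a b : 'I_k.+1) : (a < b)%N -> tnth w a = tnth w b ->
    ~~ mixed parX parY (tnth w a).
  by move=> /H; rewrite biletter_nextE => /andP[_ /implyP h] /eqP.
rewrite -val_eqE /= neq_ltn => /orP[/neq//|ji ijE].
by rewrite ijE; apply: neq ji _.
Qed.

End Words.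

Theorem theorem1 (dX dY : Order.disp_t) (X : orderType dX) (Y : orderType dY)
    (parX : X -> bool) (parY : Y -> bool)
    (k : nat) (k_gt0 : (0 < k)%N)
    (L : {mset X}%mset) (R : {mset Y}%mset)
    (sizeL : size L = k) (sizeR : size R = k) :
  set_bij (RBiw parX parY (k := k) L R) (SStd parX parY L R)
          (sRSK parX parY (k := k)).
Proof.
have good2 (w : k.-tuple (X * Y)) : RBiw parX parY L R w ->
    growth parY (rsk parX parY (rev w)).2.
  by move=> [rw ow _ _]; apply/rsk_growth2/ordered_restrictedP.
split.
- move=> w ww; have gt := good2 w ww; have gs := rsk_growth1 parX parY (rev w).
  have [_ _ <- <-] := ww; rewrite sRSK_rsk /=.
  have [lX lY] := rsk_letters parX parY (rev w).
  split=> /=; try exact: semistandard_tab.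
  + have [lam lam_part lamE] := young_is_part (growth_young gs).
    exists lam => //; split=> u; rewrite domf_tab //.
    by rewrite -rsk_boxes.
  + rewrite (content_tab gs); apply/eq_seq_msetP; apply: perm_trans lX _.
    by rewrite map_rev perm_rev.
  + by rewrite (content_tab gt) lY; apply/eq_seq_msetP; rewrite map_rev perm_rev.
- move=> w w' /set_mem ww /set_mem ww'; rewrite !sRSK_rsk => -[E1 E2].
  (* Equal tableaux have equal growths, which reduces injectivity to that of [rsk]. *)
  apply/val_inj/(inv_inj revK)/(@rsk_inj _ _ _ _ parX parY).
  rewrite (surjective_pairing (rsk _ _ (rev w))).
  rewrite (growth_inj (rsk_growth1 _ _ _) (rsk_growth1 _ _ _) E1).
  by rewrite (growth_inj (good2 _ ww) (good2 _ ww') E2) -surjective_pairing.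
- move=> [P Q] [[lam lam_part [/= PE QE]] sP sQ cP cQ] /=.
  have yP := is_part_young lam_part PE; have yQ := is_part_young lam_part QE.
  have [s gs sE] := semistandard_ex_growth sP yP.
  have [t gt tE] := semistandard_ex_growth sQ yQ.
  have stE : boxes s = boxes t.
    by rewrite -!domf_tab sE tE; apply/fsetP => u; rewrite PE QE.
  have [r rE] := rsk_surj gs gt stE; have [lX lY] := rsk_letters parX parY r.
  rewrite rE /= in lX lY.
  have cX : seq_mset (map fst r) = L.
    by rewrite -cP -sE (content_tab gs); apply/esym/eq_seq_msetP.
  have cY : seq_mset (map snd r) = R by rewrite -cQ -tE (content_tab gt) lY.
  have rk : size (rev r) == k.
    by rewrite size_rev -(size_map fst) -sizeL -cX (perm_size (perm_eq_seq_mset _)).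
  exists (Tuple rk); last by rewrite sRSK_rsk /= revK rE /= sE tE.
  (* The preimage is ordered and restricted because the entries of [Q] form a growth. *)
  have [ow rw] : ordered parX (Tuple rk) /\ restricted parX parY (Tuple rk).
    by apply/ordered_restrictedP; rewrite /= revK; apply/rsk_growth2; rewrite rE.
  split=> //=; [rewrite -cX|rewrite -cY]; apply/eq_seq_msetP;
    by rewrite map_rev perm_rev.
Qed.
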